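(* For every constant $c$ there is a constant $d$ such that the following holds: there is no algorithm that, for infinitely many $k$, given $k$ and any string $x$ of length $k+d\log k$ with $|K(x)-k|\le2\log k$, always finds a number $\lambda$ such that there is $\alpha$ with $2\log k\le\alpha\le k$ and $|\lambda_x(\alpha)-\lambda|<c\log k$.
   Context: $K$ is prefix Kolmogorov complexity w.r.t. a fixed reference universal prefix machine. For a finite set $S$, $K(S)$ is the length of a shortest program listing $S$, $\Lambda(S)=K(S)+\log|S|$ (log base 2), and $\lambda_x(\alpha)=\min\{\Lambda(S): S\text{ finite},x\in S,K(S)\le\alpha\}$. *)

(* Defs.v *)
From mathcomp Require Import all_boot all_order all_algebra finmap.
From mathcomp Require Import all_classical all_reals all_analysis.

Set Implicit Arguments.
Unset Strict Implicit.
Unset Printing Implicit Defensive.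

Import Order.TTheory GRing.Theory Num.Theory.

Local Open Scope ring_scope.

(* Algorithms are the partial recursive functions on natural numbers.  Programs
   do not carry an arity: a program reads its arguments from a list, a missing
   argument reads as 0 and superfluous ones are ignored, so that an n-ary
   partial recursive function is the restriction of a program to lists of
   length n. *)
Inductive recfun : Type :=
| RZero
| RSucc
| RProj (i : nat)
| RComp (m : nat) (f : recfun) (g : 'I_m -> recfun)
| RPrec (f g : recfun)
| RMu (f : recfun).

(* [rec_eval f v y]: on the arguments [v] the program [f] halts with output [y].
   - RPrec f g is h with h(0, v) = f(v) and h(t + 1, v) = g(t, h(t, v), v);
   - RMu f maps v to the least y with f(y, v) = 0, and diverges unless
     f(0, v), ..., f(y - 1, v) all converge to nonzero values. *)
Fixpoint rec_eval (f : recfun) (v : seq nat) (y : nat) {struct f} : Prop :=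
  match f with
  | RZero => y = 0%N
  | RSucc => y = (head 0%N v).+1
  | RProj i => y = nth 0%N v i
  | RComp m f g =>
      exists2 w : m.-tuple nat,
        forall i : 'I_m, rec_eval (g i) v (tnth w i) & rec_eval f w y
  | RPrec f g =>
      (fix rec (t y : nat) {struct t} : Prop :=
         match t with
         | 0%N => rec_eval f (behead v) y
         | t'.+1 => exists2 z, rec t' z & rec_eval g [:: t', z & behead v] y
         end) (head 0%N v) y
  | RMu f =>
      rec_eval f (y :: v) 0%N /\
      forall i : nat, (i < y)%N -> exists z, rec_eval f (i :: v) z.+1
  end.

(* The length-lexicographic identification of binary strings with natural
   numbers: the empty string, 0, 1, 00, 01, ... are 0, 1, 2, 3, 4, ... *)
Definition strcode (x : bitseq) : nat :=
  foldl (fun n (b : bool) => (n.*2.+1 + b)%N) 0%N x.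

Definition listcode (l : seq bitseq) : nat :=
  CodeSeq.code [seq strcode x | x <- l].

(* Every natural number denotes a rational number, and every rational number is
   denoted: the code of [:: a; b; q] denotes (a - b) / (q + 1). *)
Definition ratdecode (n : nat) : rat :=
  let s := CodeSeq.decode n in
  ((nth 0%N s 0)%:R - (nth 0%N s 1)%:R) / (nth 0%N s 2).+1%:R.

Definition prefix_machine (V : recfun) : Prop :=
  forall (p q : bitseq) (y z : nat),
    rec_eval V [:: strcode p] y -> rec_eval V [:: strcode q] z ->
    prefix p q -> p = q.

Definition universal_prefix_machine (U : recfun) : Prop :=
  prefix_machine U /\
  forall V : recfun, prefix_machine V ->
    exists w : bitseq, forall (p : bitseq) (y : nat),
      rec_eval U [:: strcode (w ++ p)] y <-> rec_eval V [:: strcode p] y.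

(* The length of a shortest program on which U halts with an output in Y.  The
   default value 0 is never taken when U is universal and Y is nonempty. *)
Definition complexity (U : recfun) (Y : set nat) : nat :=
  let has_program n :=
    `[< exists p : bitseq, size p = n /\
          exists2 y, Y y & rec_eval U [:: strcode p] y >] in
  match pselect (exists n, has_program n) with
  | left ex => ex_minn ex
  | right _ => 0%N
  end.

Definition Kstr (U : recfun) (x : bitseq) : nat :=
  complexity U [set y | y = strcode x].

(* A program lists S if it outputs the elements of S without repetition, in any
   order. *)
Definition Kset (U : recfun) (S : {fset bitseq}) : nat :=
  complexity U
    [set y | exists2 l : seq bitseq, perm_eq l (enum_fset S) & y = listcode l].

Definition binlog (R : realType) (t : R) : R := ln t / ln 2.

Definition Lambda (R : realType) (U : recfun) (S : {fset bitseq}) : R :=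
  (Kset U S)%:R + binlog #|` S |%fset%:R.

(* The infimum is a minimum, since only finitely many S have K(S) <= alpha; it
   is +oo if no such S contains x. *)
Definition structure_lambda (R : realType) (U : recfun) (x : bitseq)
    (alpha : R) : \bar R :=
  ereal_inf [set (Lambda R U S)%:E | S in
    [set S : {fset bitseq} | x \in S /\ (Kset U S)%:R <= alpha]].

(* Main.v *)
Require Import Defs.
From mathcomp Require Import all_boot all_order all_algebra finmap.
From mathcomp Require Import all_classical all_reals all_analysis.
From mathcomp Require Import zify lra.

(** Fix k and an algorithm A.  Call a string of the required length large at time
    t if A has answered for it within t steps with a number above
    k + (c + 2) log k, and marked at time t if some program of length at most k
    has within t steps printed it, or listed a small set containing it, small
    meaning of log-cardinality plus program length at most k + O(log k).
    A pointer runs through the strings and leaves a string as soon as it is marked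
    or large.  Apart from passing over strings that were already marked, it moves
    because a program of length at most k has just halted or because the string
    is large.

    If there are 2^(k+2) such moves, the set of the strings so left is simple and
    of cardinality 2^(k+2), and some large string in it has complexity above k:
    its structure function is at most k + 2 log k everywhere, against the answer.
    Otherwise, since few strings are marked, the pointer stops at a string that
    is never marked, so that its structure function is everywhere above
    k + O(log k), but is never large.  Either string is described by k and by the
    number of moves before the pointer reached it, so its complexity is at most
    k + 2 log k. *)

Set Implicit Arguments.
Unset Strict Implicit.
Unset Printing Implicit Defensive.

(** * Computable functions of finite environments *)

Definition computable (f : seq nat -> nat) :=
  exists r, forall v y, rec_eval r v y <-> y = f v.

(** By induction a program inspects only finitely many positions. This bridges environments of
    arbitrary length and the tuples of fixed length that [RComp] passes on. *)
Lemma rec_eval_local r : exists m, forall v w,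
  (forall i, i < m -> nth 0 v i = nth 0 w i) ->
  forall y, rec_eval r v y <-> rec_eval r w y.
Proof.
elim: r => [||i|m f [mf Hf] g Hg|f [mf Hf] g [mg Hg]|f [mf Hf]] /=.
- by exists 0.
- by exists 1 => v w H y; rewrite -!nth0 H.
- by exists i.+1 => v w H y; rewrite H.
- have [ms Hms] := choice Hg.
  exists (\max_i ms i) => v w H y.
  have E i z : rec_eval (g i) v z <-> rec_eval (g i) w z.
    by apply: Hms => j Hj; apply: H; apply: leq_trans Hj (leq_bigmax i).
  by split=> -[u Hu fu]; exists u => // i; apply/E.
- exists (maxn mf mg).+1 => v w H y.
  have -> : head 0 v = head 0 w by rewrite -!nth0 H.
  elim: (head 0 w) y => [|t IH] y /=.
    by apply: Hf => i Hi; rewrite !nth_behead H //; lia.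
  have E z : rec_eval g [:: t, z & behead v] y <-> rec_eval g [:: t, z & behead w] y.
    by apply: Hg => -[|[|i]] //= Hi; rewrite !nth_behead H //; lia.
  by split=> -[z /IH Hz /E Hy]; exists z.
- exists mf => v w H y.
  have E i z : rec_eval f (i :: v) z <-> rec_eval f (i :: w) z.
    by apply: Hf => -[|j] //= Hj; apply: H; lia.
  by split=> -[/E H0 Hi]; split=> // i /Hi [z /E]; exists z.
Qed.

Lemma computable_ext f g : f =1 g -> computable f -> computable g.
Proof. by move=> E [r Hr]; exists r => v y; rewrite -E. Qed.

Lemma computable_nth i : computable (fun v => nth 0 v i).
Proof. by exists (RProj i). Qed.

Lemma computable_succ : computable (fun v => (nth 0 v 0).+1).
Proof. by exists RSucc => v y; rewrite nth0. Qed.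

(* Only finitely many entries of [s v] are read, by [rec_eval_local]. *)
Lemma computable_subst f (s : seq nat -> seq nat) :
  computable f -> (forall i, computable (fun v => nth 0 (s v) i)) ->
  computable (fun v => f (s v)).
Proof.
move=> [r Hr] Hs; have [m Hm] := rec_eval_local r.
have [g Hg] := choice Hs.
exists (@RComp m r (fun i => g i)) => v y /=.
have E (w : m.-tuple nat) : (forall i : 'I_m, tnth w i = nth 0 (s v) i) ->
    rec_eval r w y <-> y = f (s v).
  move=> Hw; rewrite -Hr; apply: Hm => i Hi.
  by rewrite -(Hw (Ordinal Hi)) (tnth_nth 0).
split=> [[w Hw]|Hy].
  by move/E; apply=> i; apply/Hg.
exists [tuple nth 0 (s v) i | i < m].
  by move=> i; apply/Hg; rewrite tnth_mktuple.
by apply/E => // i; rewrite tnth_mktuple.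
Qed.

Lemma computable_behead f : computable f -> computable (fun v => f (behead v)).
Proof.
move=> Hf; apply: computable_subst => // i.
by apply: (computable_ext _ (computable_nth i.+1)) => v; rewrite nth_behead.
Qed.

Lemma computable0 : computable (fun=> 0).
Proof. by exists RZero. Qed.

Lemma computable_S a : computable a -> computable (fun v => (a v).+1).
Proof.
move=> Ha; apply: (@computable_subst _ (fun v => [:: a v]) computable_succ).
by move=> [|i] //=; rewrite nth_nil; apply: computable0.
Qed.

Lemma computable_const n : computable (fun=> n).
Proof. by elim: n => [|n IH]; [apply: computable0 | apply: computable_S]. Qed.

Lemma computable_nil i : computable (fun=> nth 0 [::] i).
Proof. by rewrite nth_nil; apply: computable0. Qed.

Lemma computable_app1 (f : nat -> nat) a :
  computable (fun v => f (nth 0 v 0)) -> computable a ->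
  computable (fun v => f (a v)).
Proof.
move=> Hf Ha; apply: (@computable_subst _ (fun v => [:: a v]) Hf).
by move=> [|i] //=; apply: computable_nil.
Qed.

Lemma computable_app2 (f : nat -> nat -> nat) a b :
  computable (fun v => f (nth 0 v 0) (nth 0 v 1)) ->
  computable a -> computable b -> computable (fun v => f (a v) (b v)).
Proof.
move=> Hf Ha Hb; apply: (@computable_subst _ (fun v => [:: a v; b v]) Hf).
by move=> [|[|i]] //=; apply: computable_nil.
Qed.

Lemma computable_app3 (f : nat -> nat -> nat -> nat) a b c :
  computable (fun v => f (nth 0 v 0) (nth 0 v 1) (nth 0 v 2)) ->
  computable a -> computable b -> computable c ->
  computable (fun v => f (a v) (b v) (c v)).
Proof.
move=> Hf Ha Hb Hc; apply: (@computable_subst _ (fun v => [:: a v; b v; c v]) Hf).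
by move=> [|[|[|i]]] //=; apply: computable_nil.
Qed.

(** [RPrec] takes its counter from the head of the list, so the recursion runs on [n v :: v]; the
    step function finds counter and accumulator in front of [v]. *)
Lemma computable_rec n b (g : nat -> nat -> seq nat -> nat) :
  computable n -> computable b ->
  computable (fun w => g (nth 0 w 0) (nth 0 w 1) (behead (behead w))) ->
  computable (fun v => nat_rect _ (b v) (fun t acc => g t acc v) (n v)).
Proof.
move=> Hn [rb Hb] [rg Hg].
have H : computable (fun w => nat_rect _ (b (behead w))
    (fun t acc => g t acc (behead w)) (head 0 w)).
  exists (RPrec rb rg) => v y /=.
  elim: (head 0 v) y => [|t IH] y /=; first exact: Hb.
  split=> [[z /IH -> /Hg //]|->].
  by eexists; [apply/IH; reflexivity | apply/Hg].
have := @computable_subst _ (fun v => n v :: v) H; apply=> -[|i] //=.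
exact: computable_nth.
Qed.

Lemma computable_pred a : computable a -> computable (fun v => (a v).-1).
Proof.
apply: (@computable_app1 predn).
apply: (computable_ext (f := fun v =>
  nat_rect _ 0 (fun t acc => t) (nth 0 v 0))); first by move=> v; case: (nth 0 v 0).
by apply: computable_rec; [apply: computable_nth | apply: computable0 | apply: computable_nth].
Qed.

Lemma computable_add a b : computable a -> computable b ->
  computable (fun v => a v + b v).
Proof.
apply: computable_app2.
apply: (computable_ext (f := fun v =>
  nat_rect _ (nth 0 v 1) (fun t acc => acc.+1) (nth 0 v 0))).
  by move=> v; elim: (nth 0 v 0) => //= n ->.
apply: computable_rec; try exact: computable_nth.
by apply: computable_S; apply: computable_nth.
Qed.

Lemma computable_sub a b : computable a -> computable b ->
  computable (fun v => a v - b v).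
Proof.
apply: computable_app2.
apply: (computable_ext (f := fun v =>
  nat_rect _ (nth 0 v 0) (fun t acc => acc.-1) (nth 0 v 1))).
  by move=> v; elim: (nth 0 v 1) => [|n /= ->]; rewrite ?subn0 ?subnS.
apply: computable_rec; try exact: computable_nth.
by apply: computable_pred; apply: computable_nth.
Qed.

Lemma computable_nth2 i : computable (fun v => nth 0 (behead (behead v)) i).
Proof. exact: computable_behead (computable_behead (computable_nth i)). Qed.

Lemma computable_mul a b : computable a -> computable b ->
  computable (fun v => a v * b v).
Proof.
apply: computable_app2.
apply: (computable_ext (f := fun v =>
  nat_rect _ 0 (fun t acc => nth 0 v 1 + acc) (nth 0 v 0))).
  by move=> v; elim: (nth 0 v 0) => //= n ->; rewrite mulSn.
apply: (@computable_rec _ _ (fun t acc v => nth 0 v 1 + acc)); try exact: computable_nth.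
  exact: computable0.
by apply: computable_add; [apply: computable_nth2 | apply: computable_nth].
Qed.

Lemma computable_exp a b : computable a -> computable b ->
  computable (fun v => a v ^ b v).
Proof.
apply: computable_app2.
apply: (computable_ext (f := fun v =>
  nat_rect _ 1 (fun t acc => nth 0 v 0 * acc) (nth 0 v 1))).
  by move=> v; elim: (nth 0 v 1) => //= n ->; rewrite expnS.
apply: (@computable_rec _ _ (fun t acc v => nth 0 v 0 * acc)); try exact: computable_nth.
  exact: computable_const.
by apply: computable_mul; [apply: computable_nth2 | apply: computable_nth].
Qed.

Definition decidable_env (P : seq nat -> bool) := computable (fun v => P v : nat).

Lemma computable_if P a b : decidable_env P -> computable a -> computable b ->
  computable (fun v => if P v then a v else b v).
Proof.
move=> HP Ha Hb; apply: (computable_ext (f := fun v => P v * a v + (1 - P v) * b v)).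
  by move=> v; case: (P v); rewrite ?mul1n ?mul0n ?addn0.
do ?[apply: computable_add | apply: computable_mul | apply: computable_sub] => //.
exact: computable_const.
Qed.

Lemma decidable_leq a b : computable a -> computable b ->
  decidable_env (fun v => a v <= b v).
Proof.
move=> Ha Hb; apply: (computable_ext (f := fun v => 1 - (a v - b v))).
  by move=> v; case: leqP; lia.
by do ?apply: computable_sub => //; apply: computable_const.
Qed.

Lemma decidable_and P Q : decidable_env P -> decidable_env Q ->
  decidable_env (fun v => P v && Q v).
Proof.
move=> HP HQ; apply: (computable_ext (f := fun v => P v * Q v)).
  by move=> v; case: (P v); case: (Q v).
exact: computable_mul.
Qed.

Lemma decidable_neg P : decidable_env P -> decidable_env (fun v => ~~ P v).
Proof.
move=> HP; apply: (computable_ext (f := fun v => 1 - P v)).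
  by move=> v; case: (P v).
by apply: computable_sub => //; apply: computable_const.
Qed.

Lemma decidable_or P Q : decidable_env P -> decidable_env Q ->
  decidable_env (fun v => P v || Q v).
Proof.
move=> HP HQ; apply: (computable_ext (f := fun v => ~~ (~~ P v && ~~ Q v))).
  by move=> v; rewrite negb_and !negbK.
by apply: decidable_neg; apply: decidable_and; apply: decidable_neg.
Qed.

Lemma decidable_eq a b : computable a -> computable b ->
  decidable_env (fun v => a v == b v).
Proof.
move=> Ha Hb; apply: (computable_ext (f := fun v => (a v <= b v) && (b v <= a v))).
  by move=> v; rewrite eqn_leq.
by apply: decidable_and; apply: decidable_leq.
Qed.

Lemma iota0S m : iota 0 m.+1 = iota 0 m ++ [:: m].
Proof. by rewrite -addn1 iotaD. Qed.

Lemma decidable_has n (P : nat -> seq nat -> bool) :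
  computable n -> decidable_env (fun w => P (nth 0 w 0) (behead w)) ->
  decidable_env (fun v => has (P^~ v) (iota 0 (n v))).
Proof.
move=> Hn HP; apply: (computable_ext (f := fun v =>
  nat_rect _ 0 (fun t acc => (0 < acc) || P t v : nat) (n v))).
  move=> v; elim: (n v) => // m; rewrite iota0S has_cat /= orbF => ->.
  by case: has.
apply: (@computable_rec _ _ (fun t acc v => (0 < acc) || P t v : nat)) => //.
  exact: computable0.
apply: decidable_or.
  by apply: decidable_leq; [apply: computable_const | apply: computable_nth].
apply: (@computable_subst (fun w => P (nth 0 w 0) (behead w))
  (fun w => nth 0 w 0 :: behead (behead w))) => // -[|i] /=.
  exact: computable_nth.
exact: computable_nth2.
Qed.

Lemma computable_find n (P : nat -> seq nat -> bool) :
  computable n -> decidable_env (fun w => P (nth 0 w 0) (behead w)) ->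
  computable (fun v => find (P^~ v) (iota 0 (n v))).
Proof.
(* The accumulator equals the number [t] of candidates tested exactly as long as all of them have
   failed, so it advances only then. *)
move=> Hn HP; apply: (computable_ext (f := fun v =>
  nat_rect _ 0 (fun t acc => if (acc == t) && ~~ P t v then t.+1 else acc) (n v))).
  move=> v; elim: (n v) => // m; rewrite iota0S find_cat /= size_iota => ->.
  have := has_find (P^~ v) (iota 0 m); rewrite size_iota => ->.
  have := find_size (P^~ v) (iota 0 m); rewrite size_iota.
  case: ltngtP => [lt _|//|-> _] //=.
  by case: (P m v); rewrite ?addn1 ?addn0.
apply: (@computable_rec _ _
  (fun t acc v => if (acc == t) && ~~ P t v then t.+1 else acc)) => //.
  exact: computable0.
apply: computable_if; try exact: computable_nth.
- apply: decidable_and; first by apply: decidable_eq; apply: computable_nth.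
  apply: decidable_neg.
  apply: (@computable_subst (fun w => P (nth 0 w 0) (behead w))
    (fun w => nth 0 w 0 :: behead (behead w))) => // -[|i] /=.
    exact: computable_nth.
  exact: computable_nth2.
- by apply: computable_S; apply: computable_nth.
Qed.

(** An unbounded search, the source of the partial machines below. [RMu] looks for a zero, whence
    the negated test. *)
Lemma exists_mu (test : seq nat -> bool) (out : seq nat -> nat) :
  decidable_env test -> computable out ->
  exists r, forall v y, rec_eval r v y <->
    exists2 u, test (u :: v) /\ (forall i, i < u -> ~~ test (i :: v)) &
               y = out (u :: v).
Proof.
move=> /decidable_neg [rt Ht] [ro Ho].
have [m Hm] := rec_eval_local ro.
(* The tuple fed to [ro] is the witness found, followed by the first [m] arguments; [ro] depends on
   no more than [m] entries. *)
exists (@RComp m.+1 ro (fun i => if i == 0 :> nat then RMu rt else RProj i.-1)).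
move=> v y /=.
have E u : rec_eval (RMu rt) v u <->
    test (u :: v) /\ (forall i, i < u -> ~~ test (i :: v)).
  rewrite /= Ht; split=> -[H1 H2]; split.
  - by move: H1; case: (test _).
  - by move=> i /H2 [z /Ht]; case: (test _).
  - by rewrite H1.
  - by move=> i /H2 Hi; exists 0; apply/Ht; rewrite Hi.
split=> [[w Hw Hy]|[u /E Hu ->]].
  exists (tnth w ord0); first by apply/E; apply: (Hw ord0).
  apply/Ho; apply/(Hm w) => //= i Hi; have Hi' : i < m.+1 by lia.
  rewrite -[nth 0 w i](tnth_nth 0 w (Ordinal Hi')).
  have := Hw (Ordinal Hi').
  case: i Hi Hi' => [|i] Hi Hi' /=; last by [].
  by move=> _; congr tnth; apply: val_inj.
exists [tuple nth 0 (u :: v) i | i < m.+1].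
  move=> i; rewrite tnth_mktuple; case: eqP => [->|H] //=.
  by case: i H => -[].
apply/(Hm _ (u :: v)); last exact/Ho.
move=> i Hi; have Hi' : i < m.+1 by lia.
by rewrite (_ : i = Ordinal Hi') // -tnth_nth tnth_mktuple.
Qed.

(** * Step-bounded evaluation *)

(* The accumulator is [0] while searching, [1] after a divergence and [j.+2]
   once [j] has been found. *)
Definition mu_upto (e : nat -> nat) (n : nat) : nat :=
  (nat_rect (fun=> nat) 0 (fun j acc =>
     if 0 < acc then acc else
     if e j == 1 then j.+2 else if e j == 0 then 1 else 0) n).-1.

(** In the values of [e], 0 stands for no value, 1 for the value 0 and more for a nonzero value; the
    right-hand side is then the clause of [RMu], cut at [n]. *)
Lemma mu_uptoP e n j : mu_upto e n = j.+1 <->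
  [/\ j < n, e j = 1 & forall i, i < j -> 1 < e i].
Proof.
rewrite /mu_upto; set J := nat_rect _ _ _.
have J0 m : J m = 0 <-> forall i, i < m -> 1 < e i.
  elim: m => [|m IH] //=; split.
    case: posnP => [/IH H|]; last by lia.
    case: eqP => // e1; case: eqP => // e0 _ i.
    rewrite ltnS leq_eqVlt => /orP[/eqP->|/H //]; lia.
  move=> H; have -> : J m = 0 by apply/IH => i Hi; apply: H; lia.
  by have /= := H m (leqnn _); case: (e m) => [|[|]].
suff H m : J m = j.+2 <-> [/\ j < m, e j = 1 & forall i, i < j -> 1 < e i].
  by rewrite -H; split=> [|->] //; case: (J n) => //= p ->.
elim: m => [|m IH] /=; first by split=> // -[].
case: posnP => [Jm|].
  have /J0 Hm := Jm; split.
    case: eqP => [e1 [<-]|e1]; first by split.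
    by case: eqP.
  case; rewrite ltnS leq_eqVlt => /orP[/eqP-> -> //|/Hm] + e1; by rewrite e1.
move=> Jm; rewrite IH; split=> -[lt e1 H]; split=> //; first by lia.
move: lt; rewrite ltnS leq_eqVlt => /orP[/eqP E|//].
by have := J0 m; rewrite -E => -[_ /(_ H)]; rewrite E; lia.
Qed.

(* [eval_upto r t v] is [y.+1] if [r] halts on [v] with output [y] when every
   unbounded search is cut at [t], and [0] if it does not. *)
Fixpoint eval_upto (r : recfun) (t : nat) (v : seq nat) {struct r} : nat :=
  match r with
  | RZero => 1
  | RSucc => (head 0 v).+2
  | RProj i => (nth 0 v i).+1
  | RComp m f g =>
      if all (fun i => 0 < eval_upto (g i) t v) (enum 'I_m)
      then eval_upto f t [seq (eval_upto (g i) t v).-1 | i <- enum 'I_m] else 0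
  | RPrec f g =>
      nat_rect (fun=> nat) (eval_upto f t (behead v))
        (fun n z => if 0 < z then eval_upto g t [:: n, z.-1 & behead v] else 0)
        (head 0 v)
  | RMu f => mu_upto (fun j => eval_upto f t (j :: v)) t
  end.

Lemma computable_nth_map (I : Type) (s : seq I) (h : I -> seq nat -> nat) j :
  (forall i, computable (h i)) ->
  computable (fun v => nth 0 [seq h i v | i <- s] j).
Proof.
move=> Hh; elim: s j => [|i s IH] [|j] //=; exact: computable0.
Qed.

Lemma decidable_all (I : Type) (s : seq I) (P : I -> seq nat -> bool) :
  (forall i, decidable_env (P i)) -> decidable_env (fun v => all (P^~ v) s).
Proof.
move=> HP; elim: s => [|i s IH] /=; first exact: computable_const.
exact: decidable_and.
Qed.

Lemma computable_behead2_cons r a b :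
  computable (fun w => eval_upto r (nth 0 w 0) (behead w)) ->
  computable a -> computable b ->
  computable (fun w => eval_upto r (nth 0 (behead (behead w)) 0)
    [:: a w, b w & behead (behead (behead (behead w)))]).
Proof.
move=> H Ha Hb; apply: (@computable_subst _ (fun w =>
  [:: nth 0 (behead (behead w)) 0, a w, b w & behead (behead (behead (behead w)))]) H).
move=> [|[|[|i]]] //=; first exact: computable_nth2.
exact: (computable_behead (computable_behead (computable_nth2 i))).
Qed.

Lemma decidable_pos a : computable a -> decidable_env (fun v => 0 < a v).
Proof. by apply: decidable_leq; apply: computable_const. Qed.

(** The program is fixed and only the bound and the arguments vary, so induction on [r] suffices and
    no universal function is needed. The bound travels at the head of the environment. *)
Lemma computable_eval_upto_cons r :
  computable (fun w => eval_upto r (nth 0 w 0) (behead w)).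
Proof.
elim: r => [||i|m f Hf g Hg|f Hf g Hg|f Hf] /=.
- exact: computable_const.
- by do 2!apply: computable_S; apply: (computable_ext _ (computable_nth 1)) => -[|? []].
- by apply: computable_S; apply: (computable_behead (computable_nth i)).
- apply: computable_if; last exact: computable0.
    by apply: decidable_all => i; apply: decidable_pos.
  apply: (@computable_subst _ (fun w => nth 0 w 0 ::
    [seq (eval_upto (g i) (nth 0 w 0) (behead w)).-1 | i <- enum 'I_m]) Hf).
  move=> [|j] /=; first exact: computable_nth.
  apply: (@computable_nth_map _ _ (fun i w =>
    (eval_upto (g i) (nth 0 w 0) (behead w)).-1)) => i.
  exact: computable_pred.
- apply: (@computable_rec _ _ (fun n z w => if 0 < z then
    eval_upto g (nth 0 w 0) [:: n, z.-1 & behead (behead w)] else 0)).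
  + by apply: (computable_ext _ (computable_nth 1)) => -[|? []].
  + apply: (@computable_subst _ (fun w => nth 0 w 0 :: behead (behead w)) Hf).
    by move=> [|i] /=; [apply: computable_nth | apply: computable_nth2].
  + apply: computable_if; last exact: computable0.
      exact: decidable_pos (computable_nth 1).
    apply: computable_behead2_cons => //; first exact: computable_nth.
    exact: computable_pred (computable_nth 1).
- apply: computable_pred.
  apply: (@computable_rec _ _ (fun j acc w => if 0 < acc then acc else
    if eval_upto f (nth 0 w 0) (j :: behead w) == 1 then j.+2 else
    if eval_upto f (nth 0 w 0) (j :: behead w) == 0 then 1 else 0)).
  + exact: computable_nth.
  + exact: computable0.
  + have He : computable (fun w => eval_upto f (nth 0 (behead (behead w)) 0)
        (nth 0 w 0 :: behead (behead (behead w)))).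
      apply: (@computable_subst _ (fun w =>
        [:: nth 0 (behead (behead w)) 0, nth 0 w 0 & behead (behead (behead w))]) Hf).
      move=> [|[|i]] /=; first exact: computable_nth2.
        exact: computable_nth.
      exact: (computable_behead (computable_nth2 i)).
    apply: computable_if; first exact: decidable_pos (computable_nth 1).
      exact: computable_nth.
    apply: computable_if; first by apply: decidable_eq => //; apply: computable_const.
      by do 2!apply: computable_S; apply: computable_nth.
    apply: computable_if; first by apply: decidable_eq => //; apply: computable_const.
      exact: computable_const.
    exact: computable_const.
Qed.

Lemma computable_eval_upto1 r t a : computable t -> computable a ->
  computable (fun v => eval_upto r (t v) [:: a v]).
Proof.
move=> Ht Ha; apply: (@computable_subst _ (fun v => [:: t v; a v])
  (computable_eval_upto_cons r)).
by move=> [|[|i]] //=; apply: computable_nil.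
Qed.

Lemma computable_eval_upto2 r t a b :
  computable t -> computable a -> computable b ->
  computable (fun v => eval_upto r (t v) [:: a v; b v]).
Proof.
move=> Ht Ha Hb; apply: (@computable_subst _ (fun v => [:: t v; a v; b v])
  (computable_eval_upto_cons r)).
by move=> [|[|[|i]]] //=; apply: computable_nil.
Qed.

(** A search succeeds at bound [t] only if all earlier values have converged by then, so a larger
    bound cannot turn up a smaller zero. *)
Lemma eval_upto_mono r t u v y :
  t <= u -> eval_upto r t v = y.+1 -> eval_upto r u v = y.+1.
Proof.
move=> tu; elim: r v y => [||i|m f Hf g Hg|f Hf g Hg|f Hf] v y //=.
- case: ifP => // /allP A E.
  have Eg i : eval_upto (g i) u v = eval_upto (g i) t v.
    have := A i; rewrite mem_enum => /(_ isT).
    by case E' : (eval_upto (g i) t v) => [|z] // _; apply: Hg.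
  have -> : all (fun i => 0 < eval_upto (g i) u v) (enum 'I_m).
    by apply/allP => i /A; rewrite Eg.
  by under eq_map => i do rewrite Eg; apply: Hf.
- elim: (head 0 v) y => [|n IH] y /=; first exact: Hf.
  set z := nat_rect _ _ _ n in IH *; case: posnP => // z0.
  by rewrite (IH z.-1 (esym (prednK z0))) /=; apply: Hg.
- rewrite !mu_uptoP => -[lt e1 H]; split; [lia | exact: Hf |].
  move=> i /H; case E : (eval_upto f t (i :: v)) => [|[|z]] // _.
  by rewrite (Hf _ _ E).
Qed.

Lemma eval_upto_sound r t v y : eval_upto r t v = y.+1 -> rec_eval r v y.
Proof.
elim: r v y => [||i|m f Hf g Hg|f Hf g Hg|f Hf] v y /=; try by case.
- case: ifP => // /allP A /Hf E.
  exists (map_tuple (fun i => (eval_upto (g i) t v).-1) (ord_tuple m)).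
    move=> i; apply: Hg; rewrite tnth_map tnth_ord_tuple prednK //.
    by apply: A; rewrite mem_enum.
  by move: E; rewrite /= -val_ord_tuple.
- elim: (head 0 v) y => [|n IH] y /=; first exact: Hf.
  set z := nat_rect _ _ _ n in IH *; case: posnP => // z0 /Hg H.
  by exists z.-1 => //; apply: IH; rewrite prednK.
- rewrite mu_uptoP => -[_ /Hf e1 H]; split=> // i /H.
  by case E : eval_upto => [|[|z]] // _; exists z; apply: Hf.
Qed.

(** A halting computation has finitely many subcomputations; the maximum of their bounds works, by
    monotonicity. *)
Lemma eval_upto_complete r v y : rec_eval r v y -> exists t, eval_upto r t v = y.+1.
Proof.
elim: r v y => [||i|m f Hf g Hg|f Hf g Hg|f Hf] v y /=; try by move=> ->; exists 0.
- case=> w /(_ _)/Hg Hw /Hf [t0 E].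
  have [ts Hts] := choice Hw.
  exists (maxn t0 (\max_i ts i)).
  have Eg i : eval_upto (g i) (maxn t0 (\max_i ts i)) v = (tnth w i).+1.
    apply: eval_upto_mono (Hts i).
    by apply: leq_trans (leq_maxr _ _); apply: leq_bigmax.
  have -> : all (fun i => 0 < eval_upto (g i) (maxn t0 (\max_i ts i)) v) (enum 'I_m).
    by apply/allP => i _; rewrite Eg.
  under eq_map => i do rewrite Eg /=.
  rewrite map_tnth_enum; apply: eval_upto_mono E; exact: leq_maxl.
- elim: (head 0 v) y => [|n IH] y /=; first exact: Hf.
  case=> z /IH [t1 E1] /Hg [t2 E2]; exists (maxn t1 t2).
  have := @eval_upto_mono (RPrec f g) t1 (maxn t1 t2) (n :: behead v) z.
  rewrite /= => /(_ (leq_maxl _ _) E1) -> /=.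
  apply: eval_upto_mono E2; exact: leq_maxr.
- case=> /Hf [t0 E0] H.
  have {}H (i : 'I_y) : exists t, 1 < eval_upto f t (val i :: v).
    by have [z /Hf [t E]] := H i (ltn_ord i); exists t; rewrite E.
  have [ts Hts] := choice H.
  (* The bound must exceed [y] as well, since the search itself is cut at [T]. *)
  set T := maxn (maxn t0 y.+1) (\max_i ts i); exists T; apply/mu_uptoP; split.
  + rewrite /T; lia.
  + by apply: eval_upto_mono E0; rewrite /T; lia.
  + move=> i Hi; have := Hts (Ordinal Hi); set t := ts _ => /=.
    have tT : t <= T by rewrite /T; apply: leq_trans (leq_maxr _ _); apply: leq_bigmax.
    by case E : (eval_upto f t (i :: v)) => [|[|z]] // _; rewrite (eval_upto_mono tT E).
Qed.

Lemma eval_upto_pos r t u v : t <= u -> 0 < eval_upto r t v ->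
  eval_upto r u v = eval_upto r t v.
Proof.
by move=> tu; case E : (eval_upto r t v) => [|y] // _; apply: eval_upto_mono E.
Qed.

Lemma rec_eval_inj r v y z : rec_eval r v y -> rec_eval r v z -> y = z.
Proof.
move=> /eval_upto_complete [t Et] /eval_upto_complete [u Eu].
have := eval_upto_mono (leq_maxl t u) Et.
by rewrite (eval_upto_mono (leq_maxr t u) Eu) => -[].
Qed.

(** * Codes and self-delimiting programs *)

Lemma computable_nth1 i : computable (fun v => nth 0 (behead v) i).
Proof. exact: computable_behead (computable_nth i). Qed.

Lemma computable_bool P : decidable_env P -> computable (fun v => P v : nat).
Proof. by []. Qed.

Create HintDb computable.
Hint Resolve computable_nth computable_nth1 computable_nth2 computable_const
  computable_S computable_pred computable_add computable_sub computable_mul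
  computable_exp computable_if computable_find computable_bool
  computable_eval_upto1 computable_eval_upto2
  decidable_leq decidable_eq decidable_and decidable_or decidable_neg
  decidable_has : computable.

Ltac computability := auto 40 with computable nocore.

Lemma computable_double a : computable a -> computable (fun v => (a v).*2).
Proof.
move=> Ha; apply: (computable_ext (f := fun v => a v + a v)).
  by move=> v; rewrite addnn.
by computability.
Qed.

Lemma computable_trunc_log a : computable a -> computable (fun v => trunc_log 2 (a v)).
Proof.
move=> Ha; apply: (computable_ext (f := fun v =>
  find (fun j => a v < 2 ^ j.+1) (iota 0 (a v)))); last first.
  by apply: (@computable_find _ (fun j v => a v < 2 ^ j.+1)) => //;
    apply: decidable_leq; [apply: computable_S; apply: computable_behead | computability].
move=> v; case: (posnP (a v)) => [->|a0] //.
set m := a v in a0 *; have /andP[lo hi] := trunc_log_bounds (ltnSn 1) a0.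
have Hm : trunc_log 2 m < m by apply: leq_trans lo; apply: ltn_expl.
have Hhas : has (fun j => m < 2 ^ j.+1) (iota 0 m).
  by apply/hasP; exists (trunc_log 2 m) => //; rewrite mem_iota.
have := Hhas; rewrite has_find size_iota => lt.
have := nth_find 0 Hhas; rewrite nth_iota // add0n => H1.
apply/eqP; rewrite eqn_leq; apply/andP; split.
  rewrite leqNgt; apply/negP => /(before_find 0).
  by rewrite nth_iota // add0n hi.
have := leq_ltn_trans lo H1; rewrite ltn_exp2l //; lia.
Qed.

(** [CodeSeq.code (x :: s)] is [2 ^ x * (2 q + 1)] with [q] the code of [s]. Both [x] and [q] are
    smaller than this number, so bounded searches invert it computably. *)
Definition code_head (m : nat) : nat :=
  find (fun x => has (fun q => m == 2 ^ x * q.*2.+1) (iota 0 m)) (iota 0 m).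

Definition code_tail (m : nat) : nat :=
  find (fun q => m == 2 ^ code_head m * q.*2.+1) (iota 0 m).

Definition code_drop (j m : nat) : nat :=
  nat_rect (fun=> nat) m (fun=> code_tail) j.

Definition code_nth (j m : nat) : nat := code_head (code_drop j m).

Definition code_size (m : nat) : nat :=
  find (fun j => code_drop j m == 0) (iota 0 m.+1).

Definition code_mem (x m : nat) : bool :=
  has (fun j => (code_drop j m != 0) && (code_nth j m == x)) (iota 0 m).

Definition code_cons (x m : nat) : nat := 2 ^ x * m.*2.+1.

Hint Resolve computable_double computable_trunc_log : computable.

Lemma computable_code_cons a b : computable a -> computable b ->
  computable (fun v => code_cons (a v) (b v)).
Proof. by move=> Ha Hb; rewrite /code_cons; computability. Qed.

Lemma computable_code_head a : computable a -> computable (fun v => code_head (a v)).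
Proof.
apply: (computable_app1 (f := code_head)).
apply: (@computable_find _ (fun x v =>
  has (fun q => nth 0 v 0 == 2 ^ x * q.*2.+1) (iota 0 (nth 0 v 0)))); first by computability.
apply: (@decidable_has _ (fun q w =>
  nth 0 (behead w) 0 == 2 ^ nth 0 w 0 * q.*2.+1)); by computability.
Qed.
Hint Resolve computable_code_head : computable.

Lemma computable_code_tail a : computable a -> computable (fun v => code_tail (a v)).
Proof.
apply: (computable_app1 (f := code_tail)).
apply: (@computable_find _ (fun q v =>
  nth 0 v 0 == 2 ^ code_head (nth 0 v 0) * q.*2.+1)); by computability.
Qed.
Hint Resolve computable_code_tail : computable.

Lemma computable_code_drop a b : computable a -> computable b ->
  computable (fun v => code_drop (a v) (b v)).
Proof.
apply: (computable_app2 (f := code_drop)).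
by apply: (@computable_rec _ _ (fun=> fun m _ => code_tail m)); computability.
Qed.
Hint Resolve computable_code_drop : computable.

Lemma computable_code_nth a b : computable a -> computable b ->
  computable (fun v => code_nth (a v) (b v)).
Proof. by move=> Ha Hb; rewrite /code_nth; computability. Qed.
Hint Resolve computable_code_nth : computable.

Lemma computable_code_size a : computable a -> computable (fun v => code_size (a v)).
Proof.
apply: (computable_app1 (f := code_size)).
by apply: (@computable_find _ (fun j v => code_drop j (nth 0 v 0) == 0)); computability.
Qed.

Lemma decidable_code_mem a b : computable a -> computable b ->
  decidable_env (fun v => code_mem (a v) (b v)).
Proof.
apply: (computable_app2 (f := code_mem)).
by apply: (@decidable_has _ (fun j v => (code_drop j (nth 0 v 1) != 0) &&
  (code_nth j (nth 0 v 1) == nth 0 v 0))); computability.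
Qed.
Hint Resolve computable_code_size decidable_code_mem computable_code_cons : computable.

Lemma find_iota_unique (P : nat -> bool) m x :
  x < m -> P x -> (forall y, P y -> y = x) -> find P (iota 0 m) = x.
Proof.
move=> xm Px H; have Hhas : has P (iota 0 m).
  by apply/hasP; exists x => //; rewrite mem_iota.
have := Hhas; rewrite has_find size_iota => lt.
by have := nth_find 0 Hhas; rewrite nth_iota // add0n => /H.
Qed.

Lemma code_cons_inj x y p q : code_cons x p = code_cons y q -> x = y /\ p = q.
Proof.
move=> E; have := @can_inj _ _ _ _ CodeSeq.codeK (x :: CodeSeq.decode p) (y :: CodeSeq.decode q).
rewrite /= !CodeSeq.decodeK => /(_ E) [-> ED].
by rewrite -(CodeSeq.decodeK p) ED CodeSeq.decodeK.
Qed.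

Lemma code_cons_gt x q : (x < code_cons x q) && (q < code_cons x q).
Proof.
have := ltn_expl x (ltnSn 1); rewrite /code_cons; set e := 2 ^ x; nia.
Qed.

Lemma code_headE x s : code_head (CodeSeq.code (x :: s)) = x.
Proof.
rewrite /= -/(CodeSeq.code s) -/(code_cons _ _); set q := CodeSeq.code s.
have /andP[lx lq] := code_cons_gt x q.
apply: find_iota_unique => //; first by apply/hasP; exists q; rewrite ?mem_iota.
by move=> y /hasP [q' _ /eqP /code_cons_inj []].
Qed.

Lemma code_tailE x s : code_tail (CodeSeq.code (x :: s)) = CodeSeq.code s.
Proof.
rewrite /code_tail code_headE /= -/(CodeSeq.code s) -/(code_cons _ _).
set q := CodeSeq.code s; have /andP[lx lq] := code_cons_gt x q.
by apply: find_iota_unique => // y /eqP /code_cons_inj [].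
Qed.

Lemma code_dropE j s : code_drop j (CodeSeq.code s) = CodeSeq.code (drop j s).
Proof.
elim: j => [|j IH]; first by rewrite drop0.
rewrite /code_drop /= -/(code_drop j _) IH -add1n -drop_drop.
by case: (drop j s) => [|x s'] //; rewrite code_tailE /= drop0.
Qed.

Lemma code_nthE j s : code_nth j (CodeSeq.code s) = nth 0 s j.
Proof.
rewrite /code_nth code_dropE -{2}(addn0 j) -nth_drop.
by case: (drop j s) => [|x s'] //; rewrite code_headE.
Qed.

Lemma code_eq0 s : (CodeSeq.code s == 0) = (s == [::]).
Proof. by case: s => [|x s] //=; rewrite muln_eq0 expn_eq0. Qed.

Lemma size_le_code s : size s <= CodeSeq.code s.
Proof.
elim: s => //= x s IH; have /andP[_] := code_cons_gt x (CodeSeq.code s).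
by apply: leq_ltn_trans.
Qed.

Lemma drop_eq_nil (T : eqType) (s : seq T) j : (drop j s == [::]) = (size s <= j).
Proof. by rewrite -size_eq0 size_drop subn_eq0. Qed.

Lemma code_sizeE m : code_size m = size (CodeSeq.decode m).
Proof.
rewrite -{1}(CodeSeq.decodeK m); set s := CodeSeq.decode m; have ls := size_le_code s.
have Hhas : has (fun j => code_drop j (CodeSeq.code s) == 0) (iota 0 (CodeSeq.code s).+1).
  apply/hasP; exists (size s); first by rewrite mem_iota; lia.
  by rewrite code_dropE drop_size.
have := Hhas; rewrite has_find size_iota -/(code_size _) => lt.
have := nth_find 0 Hhas; rewrite -/(code_size _) nth_iota // code_dropE code_eq0.
rewrite drop_eq_nil => ge; apply/eqP; rewrite eqn_leq ge andbT leqNgt.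
apply/negP => lt'; have := @before_find _ 0 _ _ (size s) lt'.
by rewrite nth_iota ?ltnS // add0n code_dropE drop_size.
Qed.

Lemma code_memE x m : code_mem x m = (x \in CodeSeq.decode m).
Proof.
rewrite -{1}(CodeSeq.decodeK m); set s := CodeSeq.decode m.
apply/hasP/idP => [[j _]|/(nthP 0) [j js <-]].
  rewrite code_nthE code_dropE code_eq0 drop_eq_nil -ltnNge => /andP[js /eqP<-].
  exact: mem_nth.
exists j; first by rewrite mem_iota (leq_trans js (size_le_code s)).
by rewrite code_nthE code_dropE code_eq0 drop_eq_nil -ltnNge js /=.
Qed.

(** * Binary strings as numbers, and a prefix-free code of pairs *)

Lemma strcode_rcons x b : strcode (rcons x b) = (strcode x).*2.+1 + b.
Proof. by rewrite /strcode foldl_rcons. Qed.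

(** [(strcode x).+1] has the binary numeral [x] preceded by a digit 1; appending [y] shifts it by
    [size y] places. *)
Lemma strcode_cat x y :
  strcode (x ++ y) + 2 ^ size y = (strcode x).+1 * 2 ^ size y + strcode y.
Proof.
elim/last_ind: y => [|y b IH]; first by rewrite cats0 /= expn0 addn0 addn1 muln1.
rewrite -rcons_cat !strcode_rcons size_rcons expnS.
by rewrite mulnCA; lia.
Qed.

Lemma strcode_inj : injective strcode.
Proof.
elim/last_ind => [|x b IH]; elim/last_ind => [|y c _] //; rewrite !strcode_rcons.
- by rewrite /strcode /=.
- by rewrite [strcode [::]]/strcode /=.
move=> E; have Eb : b = c.
  have := congr1 odd E; rewrite !oddD /= !odd_double /=.
  by case: b c {E} => -[].
by rewrite Eb in E *; rewrite (IH y) //; lia.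
Qed.

Lemma strcode_bounds x : 2 ^ size x <= (strcode x).+1 < 2 ^ (size x).+1.
Proof.
elim/last_ind: x => [|x b IH] //; rewrite strcode_rcons size_rcons !expnS.
by move: IH; rewrite expnS; case: b; lia.
Qed.

(** This recovers the length of a program from its number [P] as [trunc_log 2 P.+1]; the programs of
    length at most [k] are those with [P < 2 ^ (k + 1) - 1]. *)
Lemma trunc_log_strcode x : trunc_log 2 (strcode x).+1 = size x.
Proof. by apply: trunc_log_eq => //; apply: strcode_bounds. Qed.

Fixpoint bits (w n : nat) : bitseq :=
  if w is w'.+1 then rcons (bits w' n./2) (odd n) else [::].

Lemma size_bits w n : size (bits w n) = w.
Proof. by elim: w n => //= w IH n; rewrite size_rcons IH. Qed.

Lemma strcode_bits w n : n < 2 ^ w -> (strcode (bits w n)).+1 = 2 ^ w + n.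
Proof.
elim: w n => [|w IH] n /=; first by case: n.
rewrite expnS => lt; rewrite strcode_rcons.
have := IH n./2; have := odd_double_half n; set h := n./2; lia.
Qed.

Lemma bits_inj w m n : m < 2 ^ w -> n < 2 ^ w -> bits w m = bits w n -> m = n.
Proof.
move=> lm ln E; have := strcode_bits lm; rewrite E strcode_bits //; lia.
Qed.

Lemma strcode_surj n y : 2 ^ n <= y.+1 < 2 ^ n.+1 -> exists2 x, size x = n & strcode x = y.
Proof.
rewrite expnS => /andP[lo hi]; exists (bits n (y.+1 - 2 ^ n)); first exact: size_bits.
have := @strcode_bits n (y.+1 - 2 ^ n); lia.
Qed.

(* Padding [k] to a square width [a ^ 2] leaves only [a] to be given in unary,
   so that [k] costs [log k + O(sqrt (log k))] bits. *)
Definition pair_program (a k w i : nat) : bitseq :=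
  nseq a true ++ false :: bits (a ^ 2) k ++ bits w i.

Lemma size_pair_program a k w i : size (pair_program a k w i) = a ^ 2 + a + w + 1.
Proof. rewrite /pair_program size_cat /= size_cat !size_bits size_nseq; lia. Qed.

Lemma strcode_ones a : (strcode (rcons (nseq a true) false)).+1 = 2 ^ a.+2 - 2.
Proof.
rewrite strcode_rcons.
have : strcode (nseq a true) + 2 = 2 ^ a.+1.
  elim: a => // a IH; rewrite -[nseq _ _]/(ncons a.+1 true [::]).
  have -> : ncons a.+1 true [::] = rcons (nseq a true) true.
    by elim: a {IH} => //= a ->.
  by rewrite strcode_rcons expnS -IH; lia.
by rewrite [2 ^ a.+2]expnS; lia.
Qed.

(** A closed formula by which a machine can recognise such an input with arithmetic alone. *)
Lemma strcode_pair_program a k w i : k < 2 ^ (a ^ 2) -> i < 2 ^ w ->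
  (strcode (pair_program a k w i)).+1 =
  (2 ^ a.+2 - 2) * 2 ^ (a ^ 2 + w) + k * 2 ^ w + i.
Proof.
move=> lk li; rewrite /pair_program -cat_rcons catA.
have E1 := strcode_cat (rcons (nseq a true) false ++ bits (a ^ 2) k) (bits w i).
have E2 := strcode_cat (rcons (nseq a true) false) (bits (a ^ 2) k).
move: E1 E2; rewrite !size_bits strcode_ones.
have := strcode_bits lk; have := strcode_bits li; rewrite expnD.
set e := 2 ^ w; set f := 2 ^ (a ^ 2).
move: (strcode (bits w i)) (strcode (bits (a ^ 2) k)) => si sk.
move: (strcode _) (strcode _) (2 ^ a.+2 - 2) => s t A; nia.
Qed.

Lemma prefix_ones a b s t :
  prefix (nseq a true ++ false :: s) (nseq b true ++ false :: t) -> a = b /\ prefix s t.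
Proof. by elim: a b => [|a IH] [|b] //= /IH [->]. Qed.

Lemma prefix_same_size (T : eqType) (s t : seq T) :
  prefix s t -> size s = size t -> s = t.
Proof.
case/prefixP => u ->; rewrite size_cat => E.
by have /size0nil -> : size u = 0 by [lia]; rewrite cats0.
Qed.

(** The unary block determines [a], hence the width of [k]; and [k] determines the width [g k] of
    the last block. So both programs have the same length. *)
Lemma prefix_pair_program g a k i b l j :
  k < 2 ^ (a ^ 2) -> l < 2 ^ (b ^ 2) ->
  prefix (pair_program a k (g k) i) (pair_program b l (g l) j) ->
  pair_program a k (g k) i = pair_program b l (g l) j.
Proof.
move=> lk ll /[dup] pf /prefix_ones [E]; rewrite -{b}E in ll pf *.
case/prefixP => u; rewrite -catA => /eqP; rewrite eqseq_cat ?size_bits //.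
case/andP=> /eqP /(bits_inj ll lk) E _; rewrite {l}E // in ll pf *.
by apply: prefix_same_size pf _; rewrite !size_pair_program.
Qed.

(** * Complexity and the universal machine *)

Lemma complexity_le U Y p y : Y y -> rec_eval U [:: strcode p] y ->
  (complexity U Y <= size p)%N.
Proof.
move=> Yy ev; rewrite /complexity; case: pselect => // ex.
by case: ex_minnP => m _; apply; apply/asboolP; exists p; split=> //; exists y.
Qed.

Lemma complexity_attained U Y p y : Y y -> rec_eval U [:: strcode p] y ->
  exists2 q, size q = complexity U Y & exists2 z, Y z & rec_eval U [:: strcode q] z.
Proof.
move=> Yy ev; rewrite /complexity; case: pselect => [ex|[]].
  by case: ex_minnP => m /asboolP [q [<- H]] _; exists q.
by exists (size p); apply/asboolP; exists p; split=> //; exists y.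
Qed.

(* The machine does not parse its input: it searches for [a, k, i, t] passing the
   test and such that [pair_program a k (g k) i] is the input. *)
Lemma universal_pair_program U g test out :
  universal_prefix_machine U ->
  computable (fun v => g (nth 0 v 0)) ->
  decidable_env (fun v => test (nth 0 v 0) (nth 0 v 1) (nth 0 v 2)) ->
  computable (fun v => out (nth 0 v 0) (nth 0 v 1)) ->
  exists C, forall a k i t, k < 2 ^ (a ^ 2) -> i < 2 ^ g k -> test k i t ->
    exists2 u, test k i u &
    exists2 p, size p <= C + a ^ 2 + a + g k & rec_eval U [:: strcode p] (out k u).
Proof.
move=> [_ hU] Hg Ht Ho.
pose A m := code_nth 0 m. pose K m := code_nth 1 m.
pose I m := code_nth 2 m. pose T m := code_nth 3 m.
pose cond m P := [&& K m < 2 ^ (A m ^ 2), I m < 2 ^ g (K m), test (K m) (I m) (T m) &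
  P.+1 == (2 ^ (A m).+2 - 2) * 2 ^ (A m ^ 2 + g (K m)) + K m * 2 ^ g (K m) + I m].
have Cg a : computable a -> computable (fun v => g (a v)) by apply: computable_app1.
have Ct : decidable_env (fun w => cond (nth 0 w 0) (nth 0 w 1)).
  have Dt a b c : computable a -> computable b -> computable c ->
      decidable_env (fun v => test (a v) (b v) (c v)).
    exact: (@computable_app3 (fun x y z => test x y z)).
  by rewrite /cond /A /K /I /T; computability.
have Co : computable (fun w => out (K (nth 0 w 0)) (T (nth 0 w 0))).
  by apply: (computable_app2 Ho); rewrite /K /T; computability.
have [V HV] := exists_mu Ct Co.
have condP m p : cond m (strcode p) ->
    [/\ K m < 2 ^ (A m ^ 2), I m < 2 ^ g (K m), test (K m) (I m) (T m) &
        p = pair_program (A m) (K m) (g (K m)) (I m)].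
  case/and4P=> h1 h2 h3 /eqP E; split=> //; apply: strcode_inj; apply: succn_inj.
  by rewrite strcode_pair_program.
have pV : prefix_machine V.
  move=> p q y z /HV [m [/condP [h1 _ _ ->] _] _] /HV [n [/condP [h2 _ _ ->] _] _].
  exact: prefix_pair_program.
have [w Hw] := hU V pV.
(* The constant pays for the prefix [w] that makes [U] simulate [V], and for the bit ending the
   unary block. *)
exists (size w).+1 => a k i t lk li tt.
set p := pair_program a k (g k) i.
have ex : exists m, cond m (strcode p).
  exists (CodeSeq.code [:: a; k; i; t]).
  by rewrite /cond /A /K /I /T !code_nthE /= lk li tt strcode_pair_program /=.
case: (ex_minnP ex) => m cm mmin.
have [h1 h2 h3 Ep] := condP _ _ cm.
have pf : prefix p (pair_program (A m) (K m) (g (K m)) (I m)) by rewrite -Ep prefix_refl.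
have [Ea pf'] := prefix_ones pf.
(* The input determines [k] and [i], but the search may find a witness [T m] other than [t]; hence
   the existential over [u]. *)
have [Ek Ei] : k = K m /\ i = I m.
  move: pf' h1 h2; rewrite -Ea => pf' h1 h2; have /eqP := Ep.
  rewrite /p /pair_program -Ea eqseq_cat // eqxx /= eqseq_cons eqxx /=.
  rewrite eqseq_cat ?size_bits // => /andP[/eqP /bits_inj E1 /eqP E2].
  have Ek : k = K m by apply: E1.
  by split=> //; move: E2; rewrite -Ek in h2 * => /bits_inj; apply.
exists (T m); first by rewrite Ek Ei.
exists (w ++ p); first by rewrite size_cat size_pair_program; lia.
apply/Hw/HV; exists m; last by rewrite /= -Ek.
by split=> // j jm; apply/negP => cj; have := mmin j cj; rewrite leqNgt jm.
Qed.

(** * The pursuit *)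

Section Pursuit.

Variables (marked large : nat -> nat -> bool) (b : nat).

Definition pointer (t : nat) : nat :=
  nat_rect (fun=> nat) b (fun s x => x + (marked x s.+1 || large x s.+1)) t.

(* Steps over elements that were already marked before the pointer arrived are
   not counted: there are too many of them. *)
Definition kick (s : nat) : bool :=
  (marked (pointer s) s.+1 || large (pointer s) s.+1) && ~~ marked (pointer s) s.

Definition kicks (t : nat) : nat :=
  nat_rect (fun=> nat) 0 (fun s acc => acc + kick s) t.

(** Built on codes, so as to be computable. The latest element comes first, which is why [kicked]
    reverses. *)
Definition kicked_code (t : nat) : nat :=
  nat_rect (fun=> nat) 0
    (fun s acc => if kick s then code_cons (pointer s) acc else acc) t.

Definition kicked (t : nat) : seq nat :=
  rev [seq pointer s | s <- iota 0 t & kick s].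

Lemma kicked_codeE t : kicked_code t = CodeSeq.code (kicked t).
Proof.
elim: t => // t IH; rewrite /kicked iota0S filter_cat map_cat rev_cat /=.
by rewrite -/(kicked_code t) IH; case: kick.
Qed.

Lemma kicksE t : kicks t = count kick (iota 0 t).
Proof.
by elim: t => // t IH; rewrite iota0S count_cat /= -/(kicks t) IH addn0.
Qed.

Lemma size_kicked t : size (kicked t) = kicks t.
Proof. by rewrite size_rev size_map size_filter kicksE. Qed.

Lemma kicks_mono t u : t <= u -> kicks t <= kicks u.
Proof. by move/subnK <-; elim: (u - t) => //= n IH; apply: leq_trans IH (leq_addr _ _). Qed.

(** The count grows by at most one per stage, so it skips no value. *)
Lemma kicks_reach t m : m <= kicks t -> exists u, kicks u = m.
Proof.
elim: t => [|t IH] /=; first by rewrite leqn0 => /eqP->; exists 0.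
case: (leqP m (kicks t)) => [/IH //|lt le]; exists t.+1 => /=.
by move: le lt; rewrite -/(kicks t); case: kick; lia.
Qed.

Lemma pointer_mono t u : t <= u -> pointer t <= pointer u.
Proof. by move/subnK <-; elim: (u - t) => //= n IH; apply: leq_trans IH (leq_addr _ _). Qed.

Lemma pointer_kick s u : kick s -> s < u -> pointer s < pointer u.
Proof.
move=> /andP[bs _] /pointer_mono; apply: leq_trans.
by rewrite /= -/(pointer s) bs addn1.
Qed.

Lemma pointer_kick_inj s u : kick s -> kick u -> pointer s = pointer u -> s = u.
Proof.
move=> ks ku E; case: (ltngtP s u) => // lt.
  by have := pointer_kick ks lt; rewrite E ltnn.
by have := pointer_kick ku lt; rewrite E ltnn.
Qed.

Lemma kicked_uniq t : uniq (kicked t).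
Proof.
rewrite rev_uniq map_inj_in_uniq ?filter_uniq ?iota_uniq // => s u.
by rewrite !mem_filter => /andP[ks _] /andP[ku _]; apply: pointer_kick_inj.
Qed.

Lemma kickedP t x : reflect (exists2 s, (s < t) && kick s & x = pointer s) (x \in kicked t).
Proof.
rewrite mem_rev; apply: (iffP mapP) => -[s].
  by rewrite mem_filter mem_iota => /and3P[ks _ st] ->; exists s; rewrite ?ks ?andbT.
by case/andP=> st ks ->; exists s; rewrite ?mem_filter ?mem_iota ?ks.
Qed.

Hypothesis marked_mono : forall x t u, t <= u -> marked x t -> marked x u.
Hypothesis large_mono : forall x t u, t <= u -> large x t -> large x u.

(** A move off an element that was not marked yet is a kick, and a marked element stays marked. *)
Lemma passed t x : b <= x < pointer t -> marked x t \/ x \in kicked t.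
Proof.
elim: t => [|t IH] /=; first by lia.
rewrite -/(pointer t) => H; case: (ltnP x (pointer t)) => lt.
  case: IH => [|m|/kickedP [s /andP[st ks] ->]]; first by lia.
    by left; apply: marked_mono m.
  by right; apply/kickedP; exists s; rewrite ?ks ?andbT; lia.
have bt : marked (pointer t) t.+1 || large (pointer t) t.+1.
  by move: H; case: (_ || _); lia.
have -> : x = pointer t by move: H; rewrite bt; lia.
case m : (marked (pointer t) t); first by left; apply: marked_mono m.
by right; apply/kickedP; exists t; rewrite // ltnS leqnn /kick bt m.
Qed.

Lemma pointer_bound t (s : seq nat) : (forall x, marked x t -> x \in s) ->
  pointer t <= b + (kicks t + size s).
Proof.
move=> Hs; rewrite -leq_subLR -size_kicked -size_cat -(size_iota b (pointer t - b)).
apply: uniq_leq_size; first exact: iota_uniq.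
move=> x; rewrite mem_iota mem_cat => lt.
by case: (@passed t x); [lia | move/Hs ->; rewrite orbT | move->].
Qed.

(** Leaving an unmarked element is a kick, and the pointer leaves its element when this becomes
    marked; so without kicks nothing changes. *)
Lemma pointer_live t u : t <= u -> kicks t = kicks u ->
  ~~ marked (pointer t) t -> pointer u = pointer t /\ ~~ marked (pointer u) u.
Proof.
move/subnK <-; elim: (u - t) => [|n IH] //=; rewrite -/(kicks _) -/(pointer _) => E m.
have Ek : kicks t = kicks (n + t).
  by have := kicks_mono (leq_addl n t); move: E; case: kick; lia.
have [<- mn] := IH Ek m; have : ~~ kick (n + t).
  by apply/negP => k; move: E; rewrite k -Ek; lia.
rewrite /kick mn andbT => bn; rewrite (negbTE bn) addn0.
by move: bn; rewrite negb_or => /andP[].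
Qed.

(** This makes the number of kicks a description of the unmarked element under the pointer, whatever
    the stage. *)
Lemma pointer_unique t u : kicks t = kicks u ->
  ~~ marked (pointer t) t -> ~~ marked (pointer u) u -> pointer t = pointer u.
Proof.
move=> E mt mu; case: (leqP t u) => [tu|/ltnW ut].
  by have [-> _] := pointer_live tu E mt.
by have [-> _] := pointer_live ut (esym E) mu.
Qed.

(** The largest position reached is never left, so it is neither marked nor large at any later
    stage, hence by monotonicity at no stage. *)
Lemma pointer_limit B : (forall t, pointer t <= B) ->
  exists t, forall u, ~~ marked (pointer t) u && ~~ large (pointer t) u.
Proof.
move=> HB; pose P x := `[< exists t, pointer t = x >].
have ex : exists x, P x by exists b; apply/asboolP; exists 0.
have ub x : P x -> x <= B by move=> /asboolP [t <-].
case: (ex_maxnP ex ub) => _ /asboolP [t <-] mx; exists t => u.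
set w := maxn t u.
have E v : t <= v -> pointer v = pointer t.
  move=> /pointer_mono tv; apply/eqP; rewrite eqn_leq tv andbT.
  by apply: mx; apply/asboolP; exists v.
have := E w.+1; have := E w (leq_maxl _ _); rewrite /= -/(pointer w) => ->.
move=> /(_ _) H; have : ~~ (marked (pointer t) w.+1 || large (pointer t) w.+1).
  by have := H (leqW (leq_maxl _ _)); case: (_ || _); lia.
have uw : u <= w.+1 by apply: leqW (leq_maxr _ _).
rewrite negb_or => /andP[nm nl]; apply/andP; split.
  by apply: contra nm; apply: marked_mono.
by apply: contra nl; apply: large_mono.
Qed.

End Pursuit.

(* At a kick by a mark, some program must have halted at that very stage, since
   the element was not marked one stage before; so it is charged for no other
   stage. *)
Lemma kicks_le_programs N (e : nat -> nat -> nat) (mk : nat -> nat -> nat -> bool)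
    (large : nat -> nat -> bool) (b t : nat) :
  let marked x t := has (fun P => (0 < e t P) && mk P (e t P).-1 x) (iota 0 N) in
  (forall t u P, t <= u -> 0 < e t P -> e u P = e t P) ->
  (forall s, s < t -> kick marked large b s ->
     marked (pointer marked large b s) s.+1 \/
     exists2 P, P < N & exists u, e u P = (pointer marked large b s).+1) ->
  kicks marked large b t <= 2 * N.
Proof.
move=> marked emono H; set ptr := pointer marked large b in H *.
(* Each kick gets a charge: [P] if program [P] has just halted and marked the element, [P + N] if
   the element is an output of [P]. There are [2 * N] possible charges. *)
have key s : exists n, (s < t) && kick marked large b s ->
    exists2 P, P < N & (n = P /\ e s P = 0 /\ 0 < e s.+1 P) \/
                       (n = P + N /\ exists u, e u P = (ptr s).+1).
  case E : ((s < t) && kick marked large b s); last by exists 0.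
  have /andP[st ks] := E; case: (H s st ks).
    case/hasP => P; rewrite mem_iota => PN /andP[e1 m1]; exists P => _; exists P => //.
    left; split=> //; split=> //; case: (posnP (e s P)) => // e0.
    have /andP[_ /negP[]] := ks; apply/hasP; exists P; first by rewrite mem_iota.
    by rewrite e0 /= -(emono s s.+1) // m1.
  by case=> P PN [u eu]; exists (P + N) => _; exists P => //; right; split=> //; exists u.
have [f Hf] := choice key.
rewrite kicksE -size_filter -(size_map f) -(size_iota 0 (2 * N)).
apply: uniq_leq_size => [|n /mapP [s]]; last first.
  rewrite mem_filter !mem_iota => /and3P[ks _ st] ->.
  by case: (Hf s) => [|P PN [[-> _]|[-> _]]]; rewrite ?st ?ks //; lia.
rewrite map_inj_in_uniq ?filter_uniq ?iota_uniq // => s u.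
rewrite !mem_filter !mem_iota => /and3P[ks _ st] /and3P[ku _ ut] E.
case: (Hf s) => [|P PN HP]; first by rewrite st ks.
case: (Hf u) => [|Q QN HQ]; first by rewrite ut ku.
case: HP => -[fP HP]; case: HQ => -[fQ HQ]; try by move: E; rewrite fP fQ; lia.
- have EPQ : P = Q by rewrite -fP E fQ.
  rewrite -EPQ in HQ; case: HP => e0 e1; case: HQ => e0' e1'.
  case: (ltngtP s u) => // lt.
    by have := emono _ _ _ lt e1; rewrite e0' => e2; rewrite -e2 in e1.
  by have := emono _ _ _ lt e1'; rewrite e0 => e2; rewrite -e2 in e1'.
(* A program has only one output and no element is kicked twice, so a charge [P + N] occurs only
   once too. *)
- have EPQ : P = Q by move: E; rewrite fP fQ; lia.
  rewrite -EPQ in HQ; case: HP => v ev; case: HQ => w ew.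
  apply: (pointer_kick_inj ks ku); apply: succn_inj; rewrite -[LHS]ev -[RHS]ew.
  rewrite -(emono v (maxn v w)) ?leq_maxl ?ev //.
  by rewrite -[RHS](emono w (maxn v w)) ?leq_maxr ?ew.
Qed.

(** There are [2 ^ j] programs of length [j], each contributing [2 ^ (E - j)]; so each of the
    [k + 1] lengths contributes [2 ^ E]. *)
Lemma sum_block E k : k <= E ->
  \sum_(0 <= P < (2 ^ k.+1).-1) 2 ^ (E - trunc_log 2 P.+1) = k.+1 * 2 ^ E.
Proof.
elim: k => [|k IH] kE; first by rewrite big_nat1 trunc_log1 subn0 mul1n.
have le : (2 ^ k.+1).-1 <= (2 ^ k.+2).-1 by have := expnS 2 k.+1; lia.
rewrite (big_cat_nat (leq0n _) le) /= IH; last by lia.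
rewrite (eq_big_nat _ _ (F2 := fun=> 2 ^ (E - k.+1))); last first.
  move=> P HP; rewrite (@trunc_log_eq 2 k.+1) //.
  by have := expn_gt0 2 k.+1; have := expn_gt0 2 k.+2; lia.
rewrite sum_nat_const_nat.
have -> : (2 ^ k.+2).-1 - (2 ^ k.+1).-1 = 2 ^ k.+1.
  by have := expnS 2 k.+1; have := expn_gt0 2 k.+1; lia.
by rewrite -expnD subnKC // mulSn addnC.
Qed.

(** * The pursuit against an algorithm *)

(* The answers of the two cases of the pursuit are separated by [level] on one
   side and [threshold] on the other; [gap c] is large enough to keep
   [level c k] above [threshold c k] by more than [c log k]. *)
Definition gap (c : nat) : nat := 3 * c + 6.

Definition level (c k : nat) : nat := k + gap c * (trunc_log 2 k).+1.

Definition threshold (c k : nat) : nat := k + (c + 2) * (trunc_log 2 k).+1.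

(** The integer part of [k + d log k] for [d = 2 * gap c + 4], in natural numbers and thus
    computable. *)
Definition strlen (c k : nat) : nat := k + trunc_log 2 (k ^ (2 * gap c + 4)).

(** The answer [(a - b) / (q + 1)] is compared with the threshold after clearing the denominator;
    see [ratdecode_ge]. *)
Definition large (A : recfun) (c k x t : nat) : bool :=
  let e := eval_upto A t [:: k; x] in
  (0 < e) && (code_nth 1 e.-1 + (code_nth 2 e.-1).+1 * threshold c k <= code_nth 0 e.-1).

(** The size condition says that program length plus log-cardinality is at most the level. For
    programs of length at most [k] the subtraction is not truncated. *)
Definition marks (c k P y x : nat) : bool :=
  (x == y) ||
  (code_mem x y && (code_size y <= 2 ^ (level c k - trunc_log 2 P.+1))).

Definition marked (U : recfun) (c k x t : nat) : bool :=
  has (fun P => (0 < eval_upto U t [:: P]) && marks c k P (eval_upto U t [:: P]).-1 x)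
    (iota 0 (2 ^ k.+1).-1).

Definition start (c k : nat) : nat := (2 ^ strlen c k).-1.

Lemma computable_threshold c a : computable a -> computable (fun v => threshold c (a v)).
Proof. by move=> Ha; rewrite /threshold; computability. Qed.

Lemma computable_level c a : computable a -> computable (fun v => level c (a v)).
Proof. by move=> Ha; rewrite /level; computability. Qed.

Lemma computable_start c a : computable a -> computable (fun v => start c (a v)).
Proof. by move=> Ha; rewrite /start /strlen; computability. Qed.

Hint Resolve computable_threshold computable_level computable_start : computable.

Lemma decidable_large A c k x t : computable k -> computable x -> computable t ->
  decidable_env (fun v => large A c (k v) (x v) (t v)).
Proof. by move=> Hk Hx Ht; rewrite /large /=; computability. Qed.

Lemma decidable_marked U c k x t : computable k -> computable x -> computable t ->
  decidable_env (fun v => marked U c (k v) (x v) (t v)).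
Proof.
apply: (computable_app3 (f := fun k x t => marked U c k x t)).
apply: (@decidable_has _ (fun P v => (0 < eval_upto U (nth 0 v 2) [:: P]) &&
  marks c (nth 0 v 0) P (eval_upto U (nth 0 v 2) [:: P]).-1 (nth 0 v 1))).
  by computability.
by rewrite /marks; computability.
Qed.

Hint Resolve decidable_large decidable_marked : computable.

Lemma leq_level c k : k <= level c k.
Proof. exact: leq_addr. Qed.

Section Game.

Variables (U A : recfun) (c : nat).

Let ptr k := pointer (marked U c k) (large A c k) (start c k).
Let kick_at k := kick (marked U c k) (large A c k) (start c k).
Let count k := kicks (marked U c k) (large A c k) (start c k).
Let code k := kicked_code (marked U c k) (large A c k) (start c k).
Let chased k := kicked (marked U c k) (large A c k) (start c k).

Lemma computable_ptr k t : computable k -> computable t ->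
  computable (fun v => ptr (k v) (t v)).
Proof.
apply: (computable_app2 (f := ptr)).
by apply: (@computable_rec _ _ (fun s x v => x +
  (marked U c (nth 0 v 0) x s.+1 || large A c (nth 0 v 0) x s.+1))); computability.
Qed.
Hint Resolve computable_ptr : computable.

Lemma decidable_kick k t : computable k -> computable t ->
  decidable_env (fun v => kick_at (k v) (t v)).
Proof.
move=> Hk Ht; rewrite /kick_at /kick.
have Hp := computable_ptr Hk Ht; rewrite /ptr in Hp.
by computability.
Qed.
Hint Resolve decidable_kick : computable.

Lemma computable_kicks k t : computable k -> computable t ->
  computable (fun v => count (k v) (t v)).
Proof.
apply: (computable_app2 (f := count)).
by apply: (@computable_rec _ _ (fun s acc v => acc + kick_at (nth 0 v 0) s));
  computability.
Qed.

Lemma computable_kicked_code k t : computable k -> computable t ->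
  computable (fun v => code (k v) (t v)).
Proof.
apply: (computable_app2 (f := code)).
by apply: (@computable_rec _ _ (fun s acc v =>
  if kick_at (nth 0 v 0) s then code_cons (ptr (nth 0 v 0) s) acc else acc));
  computability.
Qed.
Hint Resolve computable_kicks computable_kicked_code : computable.

Lemma large_mono k x t u : t <= u -> large A c k x t -> large A c k x u.
Proof.
move=> tu /andP[e0 H]; rewrite /large (eval_upto_pos tu e0) e0; exact: H.
Qed.

Lemma marked_mono k x t u : t <= u -> marked U c k x t -> marked U c k x u.
Proof.
move=> tu /hasP [P PN /andP[e0 H]]; apply/hasP; exists P => //.
by rewrite (eval_upto_pos tu e0) e0.
Qed.

(** Each program contributes its output and, if its list is short enough to mark, the members of
    that list; [sum_block] adds up the bounds on the lists. *)
Lemma marked_few k t : exists2 s : seq nat, (forall x, marked U c k x t -> x \in s) &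
  size s <= 2 ^ k.+1 + k.+1 * 2 ^ level c k.
Proof.
pose B P := 2 ^ (level c k - trunc_log 2 P.+1).
pose m P := let y := (eval_upto U t [:: P]).-1 in
  y :: if code_size y <= B P then CodeSeq.decode y else [::].
exists (flatten [seq m P | P <- iota 0 (2 ^ k.+1).-1]).
  move=> x /hasP [P PN /andP[_ H]]; apply/flattenP; exists (m P); first exact: map_f.
  rewrite inE; case/orP: H => [->|/andP[]] //; rewrite code_memE => xy ->.
  by rewrite xy orbT.
rewrite size_flatten /shape -map_comp sumnE big_map -[(2 ^ k.+1).-1]subn0.
rewrite -/(index_iota 0 _).
apply: (@leq_trans (\sum_(0 <= P < (2 ^ k.+1).-1) (1 + B P))).
  apply: leq_sum => P _ /=; rewrite add1n ltnS.
  by rewrite code_sizeE; case: ifP.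
rewrite big_split /= sum_nat_const_nat (sum_block (leq_level _ _)) muln1 subn0.
by rewrite leq_add2r leq_pred.
Qed.

(** Kicked and marked elements together cannot exhaust the strings of the required length, so the
    pointer never runs past them. *)
Lemma strlen_large k : 2 <= k ->
  2 ^ k.+2 + (2 ^ k.+1 + k.+1 * 2 ^ level c k) < 2 ^ strlen c k.
Proof.
move=> k2; rewrite /strlen /level; set g := gap c; set L := trunc_log 2 k.
have L1 : 0 < L by rewrite /L; apply: (@leq_trans (trunc_log 2 2)) => //; apply: leq_trunc_log.
have /andP[lo hi] := trunc_log_bounds (ltnSn 1) (ltnW k2).
have kL : k.+1 <= 2 ^ L.+1 by [].
have le : (2 * g + 4) * L <= trunc_log 2 (k ^ (2 * g + 4)).
  by apply: trunc_log_max => //; rewrite mulnC expnM leq_exp2r // addn4.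
apply: (@leq_trans (2 ^ (k + (2 * g + 4) * L))); last by rewrite leq_exp2l // leq_add2l.
have g1 : 0 < g by rewrite /g /gap; lia.
(* Since [1 <= L], each [L + 1] is at most [2 L]; one comes from [k + 1 <= 2 ^ (L + 1)], the other
   [g] from the level. *)
have h1 : k.+1 * 2 ^ (k + g * L.+1) <= 2 ^ (k + (2 * g + 2) * L).
  apply: (@leq_trans (2 ^ (L.+1 + (k + g * L.+1)))).
    by rewrite [X in _ <= X]expnD leq_mul2r kL orbT.
  by rewrite leq_exp2l //; nia.
have h2 : 2 ^ k.+3 <= 2 ^ (k + (2 * g + 2) * L) by rewrite leq_exp2l //; nia.
have h3 : 4 * 2 ^ (k + (2 * g + 2) * L) <= 2 ^ (k + (2 * g + 4) * L).
  by rewrite -[4]/(2 ^ 2) -expnD leq_exp2l //; nia.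
have e1 := expnS 2 k.+2; have e2 := expnS 2 k.+1; have e3 := expn_gt0 2 k.+1; lia.
Qed.

Lemma ptr_range k t : 2 <= k -> count k t <= 2 ^ k.+2 ->
  2 ^ strlen c k <= (ptr k t).+1 < 2 ^ (strlen c k).+1.
Proof.
move=> k2 ct; have [s Hs ss] := marked_few k t.
have := @pointer_bound _ (large A c k) (start c k) (@marked_mono k) t s Hs.
rewrite -/(ptr k t) -/(count k t) => ub.
have lb : start c k <= ptr k t.
  by have := @pointer_mono (marked U c k) (large A c k) (start c k) 0 t (leq0n _).
have := strlen_large k2; have := expnS 2 (strlen c k).
have := expn_gt0 2 (strlen c k); rewrite /start in lb ub; lia.
Qed.

Hypothesis hU : universal_prefix_machine U.

(* The first case is that of a stochastic string [x], with model [s], on which [A]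
   answers too much; the second that of a non-stochastic one. *)
Lemma game : exists C, forall a k, 2 <= k -> k < 2 ^ (a ^ 2) ->
  (exists x t s, [/\ [/\ x \in s, uniq s & size s = 2 ^ k.+2],
     forall y, y \in s -> 2 ^ strlen c k <= y.+1 < 2 ^ (strlen c k).+1,
     large A c k x t,
     forall P, P < (2 ^ k.+1).-1 -> ~ rec_eval U [:: P] x &
     (exists2 p, size p <= C + a ^ 2 + a & rec_eval U [:: strcode p] (CodeSeq.code s)) /\
     (exists2 p, size p <= C + a ^ 2 + a + k & rec_eval U [:: strcode p] x)]) \/
  (exists x, [/\ 2 ^ strlen c k <= x.+1 < 2 ^ (strlen c k).+1,
     forall t, ~~ large A c k x t,
     forall t, ~~ marked U c k x t &
     exists2 p, size p <= C + a ^ 2 + a + k & rec_eval U [:: strcode p] x]).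
Proof.
have D1 : decidable_env (fun v => (count (nth 0 v 0) (nth 0 v 2) == nth 0 v 1) &&
    ~~ marked U c (nth 0 v 0) (ptr (nth 0 v 0) (nth 0 v 2)) (nth 0 v 2)).
  by computability.
have D2 : decidable_env (fun v => count (nth 0 v 0) (nth 0 v 2) == 2 ^ (nth 0 v 0).+2).
  by computability.
(* A machine for the element under the pointer: [i] is the number of kicks, below [2 ^ (k + 2)]. The
   two bits beyond [k] go into the final constant. *)
have [C1 H1] := @universal_pair_program U (fun k => k.+2)
  (fun k i t => (count k t == i) && ~~ marked U c k (ptr k t) t) ptr hU
  (computable_S (computable_S (computable_nth 0))) D1
  (computable_ptr (computable_nth 0) (computable_nth 1)).
(* A machine listing the kicked set from [k] alone, hence the width 0. *)
have [C2 H2] := @universal_pair_program U (fun=> 0)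
  (fun k i t => count k t == 2 ^ k.+2) code hU (computable_const 0) D2
  (computable_kicked_code (computable_nth 0) (computable_nth 1)).
exists (C1 + C2 + 2) => a k k2 lk.
have found t : count k t < 2 ^ k.+2 -> ~~ marked U c k (ptr k t) t ->
    exists2 p, size p <= C1 + C2 + 2 + a ^ 2 + a + k & rec_eval U [:: strcode p] (ptr k t).
  move=> ct m; have [|u /andP[/eqP ku mu] [p sp rp]] := H1 a k (count k t) t lk ct.
    by rewrite eqxx.
  exists p; first by move: sp; lia.
  rewrite (_ : ptr k t = ptr k u) //; apply: pointer_unique => //; exact: marked_mono.
case: (pselect (exists t, 2 ^ k.+2 <= count k t)) => [[t0 ge]|nge]; last first.
  right; have lt t : count k t < 2 ^ k.+2.
    by rewrite ltnNge; apply/negP => le; apply: nge; exists t.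
  have rg t := @ptr_range k t k2 (ltnW (lt t)).
  have [|t Ht] := @pointer_limit _ (large A c k) (start c k) (@marked_mono k)
    (@large_mono k) (2 ^ (strlen c k).+1).
    by move=> t; have /andP[_ /ltnW/ltnW] := rg t.
  exists (ptr k t); split=> //; first by move=> u; case/andP: (Ht u).
    by move=> u; case/andP: (Ht u).
  by apply: found => //; case/andP: (Ht t).
left; have [t1 E1] := kicks_reach ge.
(* The model is read off at the stage [t2] where the machine stops; [t1] only shows that it does
   stop. *)
have [|t2 /eqP E [p sp rp]] := H2 a k 0 t1 lk isT; first exact/eqP.
rewrite /code kicked_codeE -/(chased k t2) in rp.
(* Otherwise every kick could be charged to a program of length at most [k], which allows at most
   [2 (2 ^ (k + 1) - 1)] kicks, fewer than [2 ^ (k + 2)]. *)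
have [s [st ks ns] no] : exists2 s, [/\ s < t2, kick_at k s &
    ~~ marked U c k (ptr k s) s.+1] &
    forall P, P < (2 ^ k.+1).-1 -> ~ rec_eval U [:: P] (ptr k s).
  apply: contrapT => no.
  suff : count k t2 <= 2 * (2 ^ k.+1).-1.
    by rewrite E; have := expnS 2 k.+1; have := expn_gt0 2 k.+1; lia.
  apply: (@kicks_le_programs _ (fun t P => eval_upto U t [:: P]) (marks c k)).
    by move=> t u P; apply: eval_upto_pos.
  move=> s st ks; case m : (marked U c k (ptr k s) s.+1); first by left.
  right; apply: contrapT => no'; apply: no; exists s; first by rewrite m.
  by move=> P PN /eval_upto_complete [u eu]; apply: no'; exists P => //; exists u.
have ks' := ks; move: ks' => /andP[bs ms].
(* At a kick before [t2] the count is still below its final value, so it fits into [k + 2] bits. *)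
have cs u : u < t2 -> kick_at k u -> count k u < 2 ^ k.+2.
  move=> ut ku; rewrite -E; apply: leq_trans (kicks_mono _ _ _ ut).
  by rewrite /= -/(count k u) -/(kick_at k u) ku addn1.
exists (ptr k s), s.+1, (chased k t2); split=> //.
- split; [|exact: kicked_uniq | by rewrite size_kicked].
  by apply/kickedP; exists s; rewrite ?st.
- move=> y /kickedP [u /andP[ut ku] ->]; apply: ptr_range => //.
  exact: ltnW (cs u ut ku).
- by move: bs; rewrite -/(ptr k s) (negbTE ns).
- split; first by exists p => //; lia.
  by apply: found => //; apply: cs.
Qed.

End Game.

(** * Real bounds *)

(** Ensures that the default value of [complexity] is never taken below. *)
Lemma universal_outputs U y : universal_prefix_machine U ->
  exists p, rec_eval U [:: strcode p] y.
Proof.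
move=> hU.
have [C H] := @universal_pair_program U (fun=> 0) (fun _ _ _ => true) (fun k _ => k) hU
  (computable_const 0) (computable_const 1) (computable_nth 0).
have lty : y < 2 ^ (y ^ 2).
  apply: leq_ltn_trans (ltn_expl _ (ltnSn 1)); case: y => // y; nia.
by have [u _ [p _ rp]] := H y y 0 0 lty isT isT; exists p.
Qed.

Lemma Kstr_gt U k x : universal_prefix_machine U ->
  (forall P, P < (2 ^ k.+1).-1 -> ~ rec_eval U [:: P] (strcode x)) -> k < Kstr U x.
Proof.
move=> hU no; have [p rp] := universal_outputs (strcode x) hU.
rewrite /Kstr; have [q <- [_ -> rq]] := @complexity_attained U [set y | y = strcode x]%classic p _ erefl rp.
rewrite ltnNge; apply/negP => le; apply: (no (strcode q)) => //.
have /andP[_ lt] := strcode_bounds q.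
have : 2 ^ (size q).+1 <= 2 ^ k.+1 by rewrite leq_exp2l.
by have := expn_gt0 2 k.+1; lia.
Qed.

Lemma fset_seq_perm (s : seq bitseq) : uniq s ->
  #|` [fset x in s]%fset| = size s /\ perm_eq s (enum_fset [fset x in s]%fset).
Proof.
move=> us; split; first by rewrite card_fseq undup_id.
apply: uniq_perm => // [|x]; first exact: fset_uniq.
by rewrite -[RHS]/(x \in [fset y in s]%fset) inE.
Qed.

Lemma bitseqs_of_codes n (s : seq nat) :
  (forall y, y \in s -> 2 ^ n <= y.+1 < 2 ^ n.+1) ->
  exists l, [seq strcode x | x <- l] = s.
Proof.
elim: s => [|y s IH] H; first by exists [::].
have [|l <-] := IH; first by move=> z zs; apply: H; rewrite inE zs orbT.
have [|x _ <-] := @strcode_surj n y; first by apply: H; rewrite inE eqxx.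
by exists (x :: l).
Qed.

Lemma square_bounds L : exists s, s ^ 2 <= L < s.+1 ^ 2.
Proof.
elim: L => [|L [s /andP[lo hi]]]; first by exists 0.
case: (ltnP L.+1 (s.+1 ^ 2)) => h; first by exists s; rewrite h andbT; lia.
by exists s.+1; rewrite h /=; nia.
Qed.

(** With [s] the integer square root of [L = trunc_log 2 k], the choice [a = s + 1] costs
    [L + O(sqrt L)] bits, which is at most [2 L] for large [k]. *)
Lemma width_bound C : exists k0, forall k, k0 <= k ->
  exists2 a, k < 2 ^ (a ^ 2) & C + a ^ 2 + a <= 2 * trunc_log 2 k.
Proof.
exists (2 ^ (C + 5) ^ 2) => k lek; set L := trunc_log 2 k.
have k0 : 0 < k by apply: leq_trans lek; rewrite expn_gt0.
have LC : (C + 5) ^ 2 <= L by apply: trunc_log_max.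
have [s /andP[lo hi]] := square_bounds L.
have sC : C + 5 <= s by rewrite -ltnS -ltn_sqr; apply: leq_ltn_trans LC hi.
exists s.+1; last by nia.
have /andP[_ h] := trunc_log_bounds (ltnSn 1) k0.
by apply: leq_trans h _; rewrite leq_exp2l.
Qed.

Import Order.TTheory GRing.Theory Num.Theory.

Local Open Scope ring_scope.

Section Real.

Variable R : realType.

Lemma ln2_gt0 : 0 < ln 2 :> R.
Proof. by apply: ln_gt0; rewrite ltr1n. Qed.

Lemma binlogX (x : R) n : 0 < x -> binlog (x ^+ n) = n%:R * binlog x.
Proof. by move=> x0; rewrite /binlog lnXn // -[ln x *+ n]mulr_natl mulrA. Qed.

Lemma binlog_exp2 n : binlog ((2 ^ n)%:R : R) = n%:R.
Proof.
rewrite natrX binlogX ?ltr0n // /binlog divff ?mulr1 //.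
by rewrite gt_eqF // ln2_gt0.
Qed.

Lemma ler_binlog (x y : R) : 0 < x -> x <= y -> binlog x <= binlog y.
Proof.
move=> x0 xy; rewrite /binlog ler_pM2r ?invr_gt0 ?ln2_gt0 //.
by rewrite ler_ln // posrE // (lt_le_trans x0 xy).
Qed.

Lemma ltr_binlog (x y : R) : 0 < x -> x < y -> binlog x < binlog y.
Proof.
move=> x0 xy; rewrite /binlog ltr_pM2r ?invr_gt0 ?ln2_gt0 //.
by rewrite ltr_ln // posrE // (lt_trans x0 xy).
Qed.

Lemma binlog_bounds n : (0 < n)%N ->
  (trunc_log 2 n)%:R <= binlog (n%:R : R) < (trunc_log 2 n).+1%:R.
Proof.
move=> n0; have /andP[lo hi] := trunc_log_bounds (ltnSn 1) n0.
rewrite -{1}[(trunc_log 2 n)%:R]binlog_exp2 -[(trunc_log 2 n).+1%:R]binlog_exp2.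
rewrite ler_binlog ?ltr0n ?expn_gt0 ?ler_nat //=.
by rewrite ltr_binlog ?ltr0n ?ltr_nat.
Qed.

Lemma truncn_strlen c k : (0 < k)%N ->
  Num.truncn (k%:R + (2 * gap c + 4)%:R * binlog k%:R : R) = strlen c k.
Proof.
move=> k0; apply: truncn_def; rewrite /strlen -binlogX ?ltr0n // -natrX.
have kd : (0 < k ^ (2 * gap c + 4))%N by rewrite expn_gt0 k0.
have /andP[lo hi] := binlog_bounds kd.
by rewrite natrD -addnS natrD lerD2l ltrD2l lo hi.
Qed.

Lemma ratdecode_ge (T m : nat) :
  (T%:R <= (ratr (ratdecode m) : R)) =
  (code_nth 1 m + (code_nth 2 m).+1 * T <= code_nth 0 m)%N.
Proof.
rewrite -{2 3 4}(CodeSeq.decodeK m) !code_nthE /ratdecode.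
set s := CodeSeq.decode m.
rewrite fmorph_div rmorphB /= !ratr_nat ler_pdivlMr ?ltr0n // lerBrDr addrC.
by rewrite -natrM -natrD ler_nat mulnC.
Qed.

(** Were the list no longer than [2 ^ (level - length)], the shortest program producing it would
    mark [x] on halting. *)
Lemma Lambda_ge U c k (S : {fset bitseq}) x : universal_prefix_machine U ->
  (forall t, ~~ marked U c k (strcode x) t) -> x \in S -> (Kset U S <= k)%N ->
  (level c k)%:R <= Lambda R U S.
Proof.
move=> hU nm xS; rewrite /Lambda /Kset.
set Y := [set y | exists2 l, perm_eq l (enum_fset S) & y = listcode l]%classic.
have Y0 : Y (listcode (enum_fset S)) by exists (enum_fset S).
have [p rp] := universal_outputs (listcode (enum_fset S)) hU.
have [q <- [_ [l lS ->] rq]] := complexity_attained Y0 rp => qk.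
have /eval_upto_complete [t et] := rq.
have lt : (2 ^ (level c k - size q) < size l)%N.
  rewrite ltnNge; apply/negP => le; have /hasPn := nm t => /(_ (strcode q)).
  rewrite mem_iota et /= /marks code_memE code_sizeE /listcode CodeSeq.codeK.
  rewrite trunc_log_strcode size_map le mem_map; last exact: strcode_inj.
  rewrite (perm_mem lS) xS orbT => /(_ _)/negP; apply=> //.
  have /andP[_ lt] := strcode_bounds q.
  have : (2 ^ (size q).+1 <= 2 ^ k.+1)%N by rewrite leq_exp2l.
  by have := expn_gt0 2 k.+1; lia.
have -> : #|` S|%fset = size l by rewrite (perm_size lS).
have lev : (size q <= level c k)%N := leq_trans qk (leq_level c k).
rewrite -lerBlDl -natrB // -[(_ - _)%:R]binlog_exp2.
by apply: ler_binlog; rewrite ?ltr0n ?expn_gt0 // ler_nat ltnW.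
Qed.

Lemma structure_lambda_le U x (alpha : R) (S : {fset bitseq}) :
  x \in S -> (Kset U S)%:R <= alpha ->
  (structure_lambda U x alpha <= (Lambda R U S)%:E)%E.
Proof. by move=> xS KS; apply: ge_ereal_inf; exists (Lambda R U S)%:E => //; exists S. Qed.

End Real.

Local Open Scope classical_set_scope.

Theorem mainTheorem12 (R : realType) (U : recfun)
    (hU : universal_prefix_machine U) (c : R) :
  exists d : R,
    ~ exists A : recfun,
        infinite_set [set k : nat |
          forall x : bitseq,
            size x = Num.truncn (k%:R + d * binlog k%:R) ->
            `|(Kstr U x)%:R - k%:R| <= 2 * binlog k%:R :> R ->
            exists2 r : nat, rec_eval A [:: k; strcode x] r &
              exists alpha : R,
                [/\ 2 * binlog k%:R <= alpha,
                    alpha <= k%:R &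
                    (`|structure_lambda U x alpha - (ratr (ratdecode r) : R)%:E|
                       < (c * binlog k%:R)%:E)%E]].
Proof.
pose n := (Num.truncn c).+1; have cn : c <= n%:R by apply/ltW/truncnS_gt.
exists (2 * gap n + 4)%:R => -[A infA].
have [C HC] := @game U A n hU.
(* The extra 2 pays for the log-cardinality [k + 2] of the kicked set. *)
have [k0 Hk0] := width_bound (C + 2).
have [k Hk kk0] : exists2 k, (maxn k0 2 <= k)%N & [set k : nat |
          forall x : bitseq,
            size x = Num.truncn (k%:R + (2 * gap n + 4)%:R * binlog k%:R : R) ->
            `|(Kstr U x)%:R - k%:R| <= 2 * binlog k%:R :> R ->
            exists2 r : nat, rec_eval A [:: k; strcode x] r &
              exists alpha : R,
                [/\ 2 * binlog k%:R <= alpha,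
                    alpha <= k%:R &
                    (`|structure_lambda U x alpha - (ratr (ratdecode r) : R)%:E|
                       < (c * binlog k%:R)%:E)%E]] k.
  apply: contrapT => no; apply: infA; apply: sub_finite_set (finite_II (maxn k0 2)).
  move=> k Pk /=; rewrite ltnNge; apply/negP => le; apply: no; by exists k.
move: Hk; rewrite geq_max => /andP[/Hk0 [a ka aL] k2].
have k_gt0 : (0 < k)%N by apply: ltnW.
move: kk0 => /=; rewrite truncn_strlen // => good.
have /andP[Llo Lhi] := binlog_bounds R k_gt0.
set b := binlog (k%:R : R) in good Llo Lhi; set L := trunc_log 2 k in aL Llo Lhi.
have cb : c * b <= n%:R * L.+1%:R.
  apply: (le_trans (ler_wpM2r _ cn)); first by apply: le_trans Llo; rewrite ler0n.
  by apply: ler_wpM2l; rewrite ?ler0n // ltW.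
(* A complexity between [k] and [k + 2 L] meets the promise, so [A] answers; the finite error
   excludes infinite values of the structure function. *)
have answer y p : size y = strlen n k -> (k < Kstr U y)%N ->
    (size p <= C + a ^ 2 + a + k)%N -> rec_eval U [:: strcode p] (strcode y) ->
    exists2 r, rec_eval A [:: k; strcode y] r & exists alpha l : R,
      [/\ 2 * b <= alpha, alpha <= k%:R, structure_lambda U y alpha = l%:E &
          `|l - ratr (ratdecode r)| < n%:R * L.+1%:R].
  move=> sy Ky sp rp; have [||r Ar [alpha [al ak H]]] := good y => //.
    have := @complexity_le U [set z | z = strcode y] p _ erefl rp.
    rewrite -/(Kstr U y) => Kp.
    rewrite ger0_norm; last by rewrite subr_ge0 ler_nat ltnW.
    have : (Kstr U y <= k + 2 * L)%N by lia.
    by rewrite -(ler_nat R) natrD natrM; lra.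
  exists r => //; move: H; case E : (structure_lambda U y alpha) => [l||] // H.
  by exists alpha, l; split=> //; apply: lt_le_trans cb; rewrite -lte_fin.
have [[x [t [s [[xs us ss] rs lx no [[p sp rp] [q sq rq]]]]]]|[x [rx nl nm [q sq rq]]]] :=
  HC a k k2 ka.
- have [y sy Ey] := strcode_surj (rs x xs).
  rewrite -Ey in xs lx no rq.
  have [r Ar [alpha [l [al ak El Hl]]]] := answer y q sy (Kstr_gt hU no) sq rq.
  have [ls Els] := bitseqs_of_codes rs.
  have uls : uniq ls by rewrite -(map_inj_uniq strcode_inj) Els.
  have [cS pS] := fset_seq_perm uls; set S := [fset z in ls]%fset in cS pS.
  have yS : y \in S by rewrite inE -(mem_map strcode_inj) Els.
  have KS : (Kset U S <= C + a ^ 2 + a)%N.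
    apply: leq_trans sp; apply: complexity_le rp.
    by exists ls; rewrite // /listcode Els.
  have KL : (Kset U S + 2 <= 2 * L)%N.
    by move: (Kset U S) KS aL => K; clear; lia.
  have KLR : (Kset U S)%:R + 2 <= 2 * L%:R :> R by rewrite -natrD -natrM ler_nat.
  have Kalpha : (Kset U S)%:R <= alpha by lra.
  have := structure_lambda_le yS Kalpha; rewrite El lee_fin /Lambda cS.
  rewrite -(size_map strcode) Els ss binlog_exp2 => lS.
  have big : (threshold n k)%:R <= ratr (ratdecode r) :> R.
    rewrite ratdecode_ge; move: lx => /andP[]; rewrite /large.
    case E : eval_upto => [|e] // _ /=.
    by rewrite (rec_eval_inj Ar (eval_upto_sound E)).
  (* The answer is at least [k + (n + 2)(L + 1)], the structure function at most
     [K(S) + k + 2 <= k + 2 L]; they are more than [n (L + 1)] apart. *)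
  move: big Hl lS KLR; rewrite /threshold -/L ltr_norml.
  rewrite natrD natrM natrD -!natr1; lra.
- have [y sy Ey] := strcode_surj rx.
  rewrite -Ey in nl nm rq.
  have no P : (P < (2 ^ k.+1).-1)%N -> ~ rec_eval U [:: P] (strcode y).
    move=> PN /eval_upto_complete [t et]; have /hasP[] := nm t; exists P.
      by rewrite mem_iota.
    by rewrite et /= /marks eqxx.
  have [r Ar [alpha [l [al ak El Hl]]]] := answer y q sy (Kstr_gt hU no) sq rq.
  have lev : (level n k)%:R <= l.
    rewrite -lee_fin -El; apply: le_ereal_inf_tmp => _ [S [yS KS] <-].
    rewrite lee_fin; apply: Lambda_ge nm yS _ => //.
    by rewrite -(ler_nat R); apply: le_trans ak.
  have small : ratr (ratdecode r) < (threshold n k)%:R :> R.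
    rewrite ltNge ratdecode_ge; have [t et] := eval_upto_complete Ar.
    by have := nl t; rewrite /large et.
  have nL : 0 <= n%:R * L%:R :> R by rewrite mulr_ge0.
  have LR : 0 <= L%:R :> R by [].
  have nR : 0 <= n%:R :> R by [].
  (* Here the structure function is at least [k + (3 n + 6)(L + 1)] and the answer below
     [k + (n + 2)(L + 1)], again too far apart. *)
  move: lev Hl small; rewrite /level /threshold /gap -/L ltr_norml.
  rewrite !natrD !natrM !natrD !natrM -!natr1; lra.
Qed.
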